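(* Let $\mathbb{F}$ be a field and let $\mathbf{Nil}_2(\mathbf{ACom})$ be the variety of two-step nilpotent anti-commutative algebras over $\mathbb{F}$. (1) Let $B$ and $X$ be objects of $\mathbf{Nil}_2(\mathbf{ACom})$. The isomorphism classes of split extensions of $B$ by $X$ in $\mathbf{Nil}_2(\mathbf{ACom})$ are in bijection with the algebra homomorphisms $$B\to[X]_2\colon b\mapsto b\ast-$$ which satisfy the condition $$b\ast(b'\ast x)=0,\qquad\forall b,b'\in B,\ \forall x\in X.\qquad(\dagger)$$ (2) The variety $\mathbf{Nil}_2(\mathbf{ACom})$ is weakly action representable. For each object $X$, a weak representation of $\mathrm{SplExt}(-,X)=\mathrm{SplExt}_{\mathbf{Nil}_2(\mathbf{ACom})}(-,X)$ is given by $$\tau\colon\mathrm{SplExt}(-,X)\rightarrowtail\mathrm{Hom}_{\mathbf{Nil}_2(\mathbf{ACom})}(-,[X]_2),$$ where $\tau_B$ is the injection which associates with any split extension of $B$ by $X$ the corresponding homomorphism $B\to[X]_2\colon b\mapsto b\ast-$ as in (1). (3) A homomorphism $B\to[X]_2$, $b\mapsto b\ast-$, is an acting morphism if and only if it satisfies $(\dagger)$.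
   Context: Algebras are vector spaces over $\mathbb{F}$ with a bilinear multiplication; $\mathbf{Nil}_2(\mathbf{ACom})$ is the class of algebras satisfying $xy=-yx$ and $x(yz)=(xy)z=0$, with multiplicative linear maps as morphisms. For $X$ in $\mathbf{Nil}_2(\mathbf{ACom})$, $[X]_2=\{f\in\mathrm{End}(X)\mid f(xy)=f(x)y=0,\ \forall x,y\in X\}$, where $\mathrm{End}(X)$ is the space of linear endomorphisms; it is regarded as an abelian algebra, i.e. with zero multiplication. A split extension of $B$ by $X$ in a category $\mathcal{C}$ of algebras is a diagram $X\xrightarrow{i}A\rightleftarrows B$ with $\pi\colon A\to B$, $s\colon B\to A$, $\pi s=1_B$, $i$ a kernel of $\pi$. It determines a derived action: $b\ast x=s(b)i(x)$ and $x\ast b=i(x)s(b)$, viewed as elements of $X$; the homomorphism corresponding to the split extension is $b\mapsto b\ast-$. $\mathrm{SplExt}(-,X)\colon\mathcal{C}^{\mathrm{op}}\to\mathbf{Set}$ sends $B$ to the set of isomorphism classes (isomorphisms fixing $X$ and $B$) of split extensions of $B$ by $X$, and $f\colon B'\to B$ to pullback along $f$. $\mathcal{C}$ is weakly action representable if for every $X$ there are an object $T$ of $\mathcal{C}$ and a natural transformation with injective components $\tau\colon\mathrm{SplExt}(-,X)\rightarrowtail\mathrm{Hom}_{\mathcal{C}}(-,T)$; then $(T,\tau)$ is a weak representation of $\mathrm{SplExt}(-,X)$, and a morphism $B\to T$ in the image of $\tau_B$ is called an acting morphism. *)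

(* Defs.v *)
From HB Require Import structures.
From mathcomp Require Import all_boot all_order all_algebra.
From mathcomp Require Import mathcomp_extra boolp classical_sets functions.

Set Implicit Arguments.
Unset Strict Implicit.
Unset Printing Implicit Defensive.

Import GRing.Theory.
Local Open Scope ring_scope.
Local Open Scope quotient_scope.

Reserved Notation "x ** y" (at level 40, left associativity).
Reserved Notation "{ 'ahom' A -> B }"
  (at level 0, A at level 98, B at level 99, format "{ 'ahom'  A  ->  B }").

(* Algebras are neither associative nor unital. *)
HB.mixin Record isNAlgebra (F : fieldType) A & GRing.Lmodule F A := {
  amul : A -> A -> A;
  amul_linearl : forall y, linear (amul^~ y);
  amul_linearr : forall x, linear (amul x)
}.

#[short(type="nAlgebraType")]
HB.structure Definition NAlgebra (F : fieldType) :=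
  {A of GRing.Lmodule F A & isNAlgebra F A}.

Notation "x ** y" := (amul x y) : ring_scope.

HB.mixin Record isNil2ACom (F : fieldType) A & NAlgebra F A := {
  amulC : forall x y : A, x ** y = - (y ** x);
  amul_nil2r : forall x y z : A, x ** (y ** z) = 0;
  amul_nil2l : forall x y z : A, (x ** y) ** z = 0
}.

#[short(type="nil2AComType")]
HB.structure Definition Nil2ACom (F : fieldType) :=
  {A of NAlgebra F A & isNil2ACom F A}.

HB.mixin Record isMultiplicative (F : fieldType) (A B : nAlgebraType F)
    (f : A -> B) := {
  ahomM : {morph f : x y / x ** y >-> x ** y}
}.

HB.structure Definition AHom (F : fieldType) (A B : nAlgebraType F) :=
  {f of @GRing.Linear F A B *:%R f & isMultiplicative F A B f}.

Notation "{ 'ahom' A -> B }" := (AHom.type A%type B%type) : type_scope.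

Section AlgebraTheory.
Variable F : fieldType.
Implicit Types A B C : nAlgebraType F.

Lemma amulDl A (x y z : A) : (x + y) ** z = x ** z + y ** z.
Proof. by have := amul_linearl z 1 x y; rewrite !scale1r. Qed.

Lemma amulDr A (x y z : A) : x ** (y + z) = x ** y + x ** z.
Proof. by have := amul_linearr x 1 y z; rewrite !scale1r. Qed.

Lemma amul0l A (x : A) : 0 ** x = 0.
Proof. by apply: (addIr (0 ** x)); rewrite -amulDl !add0r. Qed.

Lemma amul0r A (x : A) : x ** 0 = 0.
Proof. by apply: (addIr (x ** 0)); rewrite -amulDr !add0r. Qed.

Lemma amulZl A a (x y : A) : (a *: x) ** y = a *: (x ** y).
Proof. by have := amul_linearl y a x 0; rewrite amul0l !addr0. Qed.

Lemma amulZr A a (x y : A) : x ** (a *: y) = a *: (x ** y).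
Proof. by have := amul_linearr x a y 0; rewrite amul0r !addr0. Qed.

Lemma ahom_ext A B (f g : {ahom A -> B}) : f =1 g -> f = g.
Proof.
move=> /funext; case: f g => [f cf] [g cg] /= fg; case: g / fg cg => cg.
by congr AHom.Pack; case: cf cg => [[?] [?] [?]] [[?] [?] [?]];
  congr AHom.Class; congr (_ _); exact: Prop_irrelevance.
Qed.

Section Constructions.
Variables A B C : nAlgebraType F.

Lemma ahom_idM : {morph (idfun : A -> A) : x y / x ** y >-> x ** y}.
Proof. by []. Qed.
HB.instance Definition _ := isMultiplicative.Build F A A idfun ahom_idM.

Lemma ahom_zeroM : {morph (\0 : A -> B) : x y / x ** y >-> x ** y}.
Proof. by move=> x y /=; rewrite amul0l. Qed.
HB.instance Definition _ := isMultiplicative.Build F A B \0 ahom_zeroM.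

Lemma ahom_compM (f : {ahom B -> C}) (g : {ahom A -> B}) :
  {morph (f \o g) : x y / x ** y >-> x ** y}.
Proof. by move=> x y /=; rewrite !ahomM. Qed.
HB.instance Definition _ (f : {ahom B -> C}) (g : {ahom A -> B}) :=
  isMultiplicative.Build F A C (f \o g) (ahom_compM f g).

Definition pair_amul (p q : A * B) := (p.1 ** q.1, p.2 ** q.2).

Lemma pair_amul_linearl q : linear (pair_amul^~ q).
Proof.
by move=> a p p'; rewrite /pair_amul /= !amulDl !amulZl.
Qed.

Lemma pair_amul_linearr p : linear (pair_amul p).
Proof.
by move=> a q q'; rewrite /pair_amul /= !amulDr !amulZr.
Qed.

HB.instance Definition _ := isNAlgebra.Build F (A * B)%type
  pair_amul_linearl pair_amul_linearr.

Lemma ahom_fstM : {morph (fst : A * B -> A) : x y / x ** y >-> x ** y}.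
Proof. by []. Qed.
Lemma ahom_sndM : {morph (snd : A * B -> B) : x y / x ** y >-> x ** y}.
Proof. by []. Qed.
HB.instance Definition _ := isMultiplicative.Build F (A * B)%type A fst ahom_fstM.
HB.instance Definition _ := isMultiplicative.Build F (A * B)%type B snd ahom_sndM.

End Constructions.

Section Nil2Product.
Variables A B : nil2AComType F.

Lemma pair_amulC (p q : A * B) : p ** q = - (q ** p).
Proof. by congr (_, _); rewrite -amulC. Qed.
Lemma pair_amul_nil2r (p q r : A * B) : p ** (q ** r) = 0.
Proof. by congr (_, _); exact: amul_nil2r. Qed.
Lemma pair_amul_nil2l (p q r : A * B) : (p ** q) ** r = 0.
Proof. by congr (_, _); exact: amul_nil2l. Qed.
HB.instance Definition _ := isNil2ACom.Build F (A * B)%type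
  pair_amulC pair_amul_nil2r pair_amul_nil2l.
End Nil2Product.

End AlgebraTheory.

(* The equalizer of [g] and [h], a subalgebra of [A]; kernels and pullbacks
   are instances of it. *)
Section Equalizer.
Variables (F : fieldType) (A B : nil2AComType F) (g h : {ahom A -> B}).

Definition eqz_pred : {pred A} := fun x => g x == h x.

Lemma eqz_submod_closed : submod_closed eqz_pred.
Proof.
split=> [|a x y]; rewrite !unfold_in ?linear0 //.
by move=> /eqP gx /eqP gy; rewrite !linearP /= gx gy.
Qed.
HB.instance Definition _ :=
  GRing.isSubmodClosed.Build F A eqz_pred eqz_submod_closed.

Record equalizer := Equalizer { eqz_val : A; eqz_valP : eqz_val \in eqz_pred }.
HB.instance Definition _ := [isSub for eqz_val].
HB.instance Definition _ := [Choice of equalizer by <:].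
HB.instance Definition _ := [SubChoice_isSubLmodule of equalizer by <:].

Lemma eqz_valE (x : equalizer) : g (val x) = h (val x).
Proof. by apply/eqP; case: x. Qed.

Lemma eqz_amul_subproof (x y : equalizer) : val x ** val y \in eqz_pred.
Proof. by rewrite unfold_in !ahomM !eqz_valE. Qed.

Definition eqz_amul (x y : equalizer) := Equalizer (eqz_amul_subproof x y).

Lemma eqz_amul_linearl y : linear (eqz_amul^~ y).
Proof. by move=> a x x'; apply: val_inj; rewrite /= amulDl amulZl. Qed.
Lemma eqz_amul_linearr x : linear (eqz_amul x).
Proof. by move=> a y y'; apply: val_inj; rewrite /= amulDr amulZr. Qed.
HB.instance Definition _ := isNAlgebra.Build F equalizer
  eqz_amul_linearl eqz_amul_linearr.

Lemma eqz_amulC (x y : equalizer) : x ** y = - (y ** x).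
Proof. by apply: val_inj; rewrite /= amulC. Qed.
Lemma eqz_amul_nil2r (x y z : equalizer) : x ** (y ** z) = 0.
Proof. by apply: val_inj; rewrite /= amul_nil2r. Qed.
Lemma eqz_amul_nil2l (x y z : equalizer) : (x ** y) ** z = 0.
Proof. by apply: val_inj; rewrite /= amul_nil2l. Qed.
HB.instance Definition _ := isNil2ACom.Build F equalizer
  eqz_amulC eqz_amul_nil2r eqz_amul_nil2l.

Lemma eqz_valM : {morph eqz_val : x y / x ** y >-> x ** y}.
Proof. by []. Qed.
Lemma eqz_val_linear : linear eqz_val.
Proof. by []. Qed.
HB.instance Definition _ := GRing.isLinear.Build F equalizer A *:%R eqz_val
  eqz_val_linear.
HB.instance Definition _ := isMultiplicative.Build F equalizer A eqz_val eqz_valM.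

Section Lift.
Variables (Z : nAlgebraType F) (k : {ahom Z -> A}).
Hypothesis gkhk : forall z, g (k z) = h (k z).

Lemma eqz_lift_subproof z : k z \in eqz_pred.
Proof. by rewrite unfold_in gkhk. Qed.

Definition eqz_lift z := Equalizer (eqz_lift_subproof z).

Lemma eqz_lift_linear : linear eqz_lift.
Proof. by move=> a x y; apply: val_inj; rewrite /= linearP. Qed.
Lemma eqz_liftM : {morph eqz_lift : x y / x ** y >-> x ** y}.
Proof. by move=> x y; apply: val_inj; rewrite /= ahomM. Qed.
HB.instance Definition _ := GRing.isLinear.Build F Z equalizer *:%R eqz_lift
  eqz_lift_linear.
HB.instance Definition _ := isMultiplicative.Build F Z equalizer eqz_lift
  eqz_liftM.
End Lift.

End Equalizer.

Section PairMorphism.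
Variables (F : fieldType) (Z A B : nAlgebraType F).
Variables (f : {ahom Z -> A}) (g : {ahom Z -> B}).

Definition pair_ahom z := (f z, g z).

Lemma pair_ahom_linear : linear pair_ahom.
Proof. by move=> a x y; rewrite /pair_ahom !linearP. Qed.
Lemma pair_ahomM : {morph pair_ahom : x y / x ** y >-> x ** y}.
Proof. by move=> x y; rewrite /pair_ahom !ahomM. Qed.
HB.instance Definition _ := GRing.isLinear.Build F Z (A * B)%type *:%R pair_ahom
  pair_ahom_linear.
HB.instance Definition _ := isMultiplicative.Build F Z (A * B)%type pair_ahom
  pair_ahomM.
End PairMorphism.

Section InverseMorphism.
Variables (F : fieldType) (A B : nAlgebraType F) (u : {ahom A -> B}) (v : B -> A).
Hypotheses (uK : cancel u v) (vK : cancel v u).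

Definition inv_ahom_fun of cancel u v & cancel v u := v.
Local Notation w := (inv_ahom_fun uK vK).

Lemma inv_ahom_linear : linear w.
Proof.
by move=> a x y; apply: (can_inj uK); rewrite linearP /= !vK.
Qed.
Lemma inv_ahomM : {morph w : x y / x ** y >-> x ** y}.
Proof. by move=> x y; apply: (can_inj uK); rewrite ahomM !vK. Qed.
HB.instance Definition _ := GRing.isLinear.Build F B A *:%R w inv_ahom_linear.
HB.instance Definition _ := isMultiplicative.Build F B A w inv_ahomM.

Definition inv_ahom : {ahom B -> A} := w.
End InverseMorphism.

(* [X]_2, with End(X) realised as the space of linear functions inside the
   vector space of all functions X -> X. *)
Section Bracket2.
Variables (F : fieldType) (X : nil2AComType F).

Definition bracket2_pred : {pred X -> X} := fun f =>
  `[< linear f /\ forall x y, f (x ** y) = 0 /\ f x ** y = 0 >].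

Lemma bracket2_submod_closed : submod_closed bracket2_pred.
Proof.
split=> [|a f g].
  rewrite unfold_in; apply/asboolP; split=> [b x y|x y].
    by rewrite -[RHS]/(b *: 0 + 0) scaler0 addr0.
  by split=> //; exact: amul0l.
rewrite !unfold_in => /asboolP[lf f0] /asboolP[lg g0]; apply/asboolP.
have E x : (a *: f + g) x = a *: f x + g x by [].
split=> [b x y|x y].
  rewrite !E lf lg !scalerDr !scalerA [b * a]mulrC -!addrA; congr (_ + _).
  by rewrite addrCA.
have [fM fx] := f0 x y; have [gM gx] := g0 x y.
by rewrite !E fM gM amulDl amulZl fx gx scaler0 addr0.
Qed.
HB.instance Definition _ :=
  GRing.isSubmodClosed.Build F (X -> X) bracket2_pred bracket2_submod_closed.

Record bracket2 := Bracket2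
  { bracket2_val :> X -> X; bracket2_valP : bracket2_val \in bracket2_pred }.
HB.instance Definition _ := [isSub for bracket2_val].
HB.instance Definition _ := [Choice of bracket2 by <:].
HB.instance Definition _ := [SubChoice_isSubLmodule of bracket2 by <:].

Lemma bracket2P (f : bracket2) :
  linear f /\ forall x y, f (x ** y) = 0 /\ f x ** y = 0.
Proof. by apply/asboolP; case: f. Qed.

Lemma bracket2_ext (f g : bracket2) : f =1 g -> f = g.
Proof. by move=> /funext fg; exact: val_inj. Qed.

Definition bracket2_amul (f g : bracket2) : bracket2 := 0.

Lemma bracket2_amul_linearl g : linear (bracket2_amul^~ g).
Proof. by move=> a f f'; rewrite /bracket2_amul scaler0 addr0. Qed.
Lemma bracket2_amul_linearr f : linear (bracket2_amul f).
Proof. by move=> a g g'; rewrite /bracket2_amul scaler0 addr0. Qed.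
HB.instance Definition _ := isNAlgebra.Build F bracket2
  bracket2_amul_linearl bracket2_amul_linearr.

Lemma bracket2_amulC (f g : bracket2) : f ** g = - (g ** f).
Proof. by rewrite [- _]oppr0. Qed.
Lemma bracket2_amul_nil2r (f g h : bracket2) : f ** (g ** h) = 0.
Proof. by []. Qed.
Lemma bracket2_amul_nil2l (f g h : bracket2) : (f ** g) ** h = 0.
Proof. by []. Qed.
HB.instance Definition _ := isNil2ACom.Build F bracket2
  bracket2_amulC bracket2_amul_nil2r bracket2_amul_nil2l.
End Bracket2.

Section Kernel.
Variables (F : fieldType) (X A B : nil2AComType F).

(* The universal property of a kernel in the category Nil_2(ACom). *)
Definition is_kernel (i : {ahom X -> A}) (p : {ahom A -> B}) : Prop :=
  (forall x, p (i x) = 0) /\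
  (forall (Z : nil2AComType F) (h : {ahom Z -> A}), (forall z, p (h z) = 0) ->
     exists! k : {ahom Z -> X}, forall z, i (k z) = h z).

Variables (i : {ahom X -> A}) (p : {ahom A -> B}).
Hypothesis kip : is_kernel i p.

Lemma kernel_inj : injective i.
Proof.
have i0 x : i x = 0 -> x = 0.
  move=> ix0; have zP : i x == (\0 : {ahom X -> A}) x by rewrite ix0.
  pose K := equalizer i \0; pose e : {ahom K -> X} := @eqz_val _ _ _ i \0.
  have [|k [_ kU]] := kip.2 K (\0 : {ahom K -> A}).
    by move=> z; rewrite /= linear0.
  have ke : k = e by apply: kU => z; rewrite eqz_valE.
  have k0 : k = \0 by apply: kU => z; rewrite /= linear0.
  by have := congr1 (fun f : {ahom K -> X} => f (Equalizer zP)) (etrans (esym ke) k0).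
move=> x y ixy; apply/eqP; rewrite -subr_eq0; apply/eqP/i0.
by rewrite linearB /= ixy subrr.
Qed.

Lemma kernel_surj a : p a = 0 -> exists x, i x = a.
Proof.
move=> pa0; have aP : p a == (\0 : {ahom A -> B}) a by rewrite pa0.
pose K := equalizer p \0; pose e : {ahom K -> A} := @eqz_val _ _ _ p \0.
have [|k [kP _]] := kip.2 K e; first by move=> z; rewrite eqz_valE.
by exists (k (Equalizer aP)); rewrite kP.
Qed.
End Kernel.

Section SplitExtensions.
Variable F : fieldType.

Record splitExt (B X : nil2AComType F) := SplitExt {
  se_obj : nil2AComType F;
  se_i : {ahom X -> se_obj};
  se_p : {ahom se_obj -> B};
  se_s : {ahom B -> se_obj};
  se_sK : forall b, se_p (se_s b) = b;
  se_ker : is_kernel se_i se_p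
}.

Definition se_iso (B X : nil2AComType F) (E E' : splitExt B X) : Prop :=
  exists (u : {ahom se_obj E -> se_obj E'}) (v : {ahom se_obj E' -> se_obj E}),
    [/\ cancel u v, cancel v u,
        forall x, u (se_i E x) = se_i E' x,
        forall a, se_p E' (u a) = se_p E a &
        forall b, u (se_s E b) = se_s E' b].

(* The split short five lemma. *)
Lemma se_iso_morphism (B X : nil2AComType F) (E E' : splitExt B X)
    (u : {ahom se_obj E -> se_obj E'}) :
    (forall x, u (se_i E x) = se_i E' x) ->
    (forall a, se_p E' (u a) = se_p E a) ->
    (forall b, u (se_s E b) = se_s E' b) ->
  se_iso E E'.
Proof.
move=> ui pu us.
have uI : injective u.
  move=> a a' uaa'; apply/eqP; rewrite -subr_eq0; apply/eqP.
  have pd : se_p E (a - a') = 0 by rewrite -pu linearB /= uaa' subrr linear0.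
  have [x xE] := kernel_surj (se_ker E) pd.
  have : se_i E' x = se_i E' 0 by rewrite -ui xE linearB /= uaa' subrr linear0.
  by move=> /(kernel_inj (se_ker E')) x0; rewrite -xE x0 linear0.
have uS a' : exists a, u a = a'.
  have pd : se_p E' (a' - se_s E' (se_p E' a')) = 0.
    by rewrite linearB /= se_sK subrr.
  have [x xE] := kernel_surj (se_ker E') pd.
  exists (se_i E x + se_s E (se_p E' a')).
  by rewrite linearD /= ui us xE subrK.
pose v a' := projT1 (cid (uS a')).
have vK : cancel v u by move=> a'; exact: projT2 (cid (uS a')).
have uK : cancel u v by move=> a; apply: uI; rewrite vK.
by exists u, (inv_ahom uK vK).
Qed.

Section Classes.
Variables B X : nil2AComType F.

Lemma se_iso_refl (E : splitExt B X) : se_iso E E.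
Proof. by exists idfun, idfun; split. Qed.

Lemma se_iso_sym (E E' : splitExt B X) : se_iso E E' -> se_iso E' E.
Proof.
move=> [u [v [uK vK ui pu us]]]; exists v, u; split=> //.
- by move=> x; rewrite -ui uK.
- by move=> a; rewrite -pu vK.
- by move=> b; rewrite -us uK.
Qed.

Lemma se_iso_trans (E E' E'' : splitExt B X) :
  se_iso E E' -> se_iso E' E'' -> se_iso E E''.
Proof.
move=> [u [v [uK vK ui pu us]]] [u' [v' [uK' vK' ui' pu' us']]].
exists (u' \o u), (v \o v'); split=> [|||a|b] /=.
- exact: can_comp.
- exact: can_comp.
- by move=> x /=; rewrite ui ui'.
- by rewrite pu' pu.
- by rewrite us us'.
Qed.

Definition se_eq (E E' : {classic splitExt B X}) : bool := `[< se_iso E E' >].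

Lemma se_eq_refl : reflexive se_eq.
Proof. by move=> E; apply/asboolP/se_iso_refl. Qed.
Lemma se_eq_sym : symmetric se_eq.
Proof. by move=> E E'; apply/asboolP/asboolP; exact: se_iso_sym. Qed.
Lemma se_eq_trans : transitive se_eq.
Proof.
by move=> E' E E'' /asboolP e /asboolP e'; apply/asboolP/(se_iso_trans e e').
Qed.

Canonical se_equiv := EquivRel se_eq se_eq_refl se_eq_sym se_eq_trans.

(* SplExt(B, X), the set of isomorphism classes. *)
Definition SplExt := {eq_quot se_equiv}.

Definition se_class (E : splitExt B X) : SplExt := \pi_SplExt E.

Definition se_repr (c : SplExt) : splitExt B X := repr c.

Lemma se_reprK c : se_class (se_repr c) = c.
Proof. exact: reprK. Qed.

Lemma se_classP E E' : se_class E = se_class E' <-> se_iso E E'.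
Proof.
split=> [/eqP|e]; last by apply/eqmodP/asboolP.
by move=> /eqP/eqmodP/asboolP.
Qed.

End Classes.

Section Pullback.
Variables (B B' X : nil2AComType F) (f : {ahom B' -> B}) (E : splitExt B X).
Let A := se_obj E.

Let gA : {ahom A * B' -> B} := se_p E \o fst.
Let gB : {ahom A * B' -> B} := f \o snd.

Definition pb_obj : nil2AComType F := equalizer gA gB.

Let pb_val : {ahom pb_obj -> A * B'} := @eqz_val _ _ _ gA gB.

Definition pb_p : {ahom pb_obj -> B'} := snd \o pb_val.

Let pb_i0 : {ahom X -> A * B'} := pair_ahom (se_i E) \0.
Let pb_s0 : {ahom B' -> A * B'} := pair_ahom (se_s E \o f) idfun.

Lemma pb_i_subproof x : gA (pb_i0 x) = gB (pb_i0 x).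
Proof. by rewrite /= (se_ker E).1 linear0. Qed.

Lemma pb_s_subproof b : gA (pb_s0 b) = gB (pb_s0 b).
Proof. by rewrite /= se_sK. Qed.

Definition pb_i : {ahom X -> pb_obj} := eqz_lift pb_i_subproof.
Definition pb_s : {ahom B' -> pb_obj} := eqz_lift pb_s_subproof.

Lemma pb_sK b : pb_p (pb_s b) = b.
Proof. by []. Qed.

Lemma pb_ker : is_kernel pb_i pb_p.
Proof.
split=> [//|Z h ph0].
pose hA : {ahom Z -> A} := fst \o (pb_val \o h).
have [|k [kP kU]] := (se_ker E).2 Z hA.
  by move=> z; have /= -> := eqz_valE (h z); rewrite [_.2]ph0 linear0.
exists k; split=> [z|k' k'P].
  apply: val_inj; apply: injective_projections; first exact: kP.
  exact: esym (ph0 z).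
by apply: kU => z; rewrite /hA /= -k'P.
Qed.

Definition se_pullback : splitExt B' X := SplitExt pb_sK pb_ker.
End Pullback.

Section Comparison.
Variables (B B' X : nil2AComType F) (f : {ahom B' -> B}).
Variables (E' : splitExt B' X) (E : splitExt B X).
Variable w : {ahom se_obj E' -> se_obj E}.
Hypothesis wi : forall x, w (se_i E' x) = se_i E x.
Hypothesis wp : forall a, se_p E (w a) = f (se_p E' a).
Hypothesis ws : forall b, w (se_s E' b) = se_s E (f b).

Let w0 : {ahom se_obj E' -> se_obj E * B'} := pair_ahom w (se_p E').

Lemma se_pullbackP : se_iso E' (se_pullback f E).
Proof.
pose u : {ahom se_obj E' -> se_obj (se_pullback f E)} :=
  eqz_lift (g := se_p E \o fst) (h := f \o snd) (k := w0) wp.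
apply: (se_iso_morphism (u := u)) => [x|a|b] //.
  by apply: val_inj; apply: injective_projections; rewrite /= ?wi ?(se_ker E').1.
by apply: val_inj; apply: injective_projections; rewrite /= ?ws ?se_sK.
Qed.
End Comparison.

Lemma se_pullback_iso (B B' X : nil2AComType F) (f : {ahom B' -> B})
  (E E' : splitExt B X) :
  se_iso E E' -> se_iso (se_pullback f E) (se_pullback f E').
Proof.
move=> [u [v [uK vK ui pu us]]].
pose w : {ahom se_obj (se_pullback f E) -> se_obj E'} := u \o (fst \o @eqz_val _ _ _ _ _).
apply: (se_pullbackP (w := w)) => [x|a|b]; rewrite /w /= ?ui ?us //.
by rewrite pu; exact: (eqz_valE a).
Qed.

Lemma se_pullback_id (B X : nil2AComType F) (E : splitExt B X) :
  se_iso E (se_pullback idfun E).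
Proof. exact: (se_pullbackP (w := idfun)). Qed.

Lemma se_pullback_comp (B B' B'' X : nil2AComType F) (f : {ahom B' -> B})
  (g : {ahom B'' -> B'}) (E : splitExt B X) :
  se_iso (se_pullback g (se_pullback f E)) (se_pullback (f \o g) E).
Proof.
pose w : {ahom se_obj (se_pullback g (se_pullback f E)) -> se_obj E} :=
  fst \o (@eqz_val _ _ _ _ _ \o (fst \o @eqz_val _ _ _ _ _)).
apply: (se_pullbackP (w := w)) => // a; rewrite /w /=.
by have := eqz_valE (val a).1 => /= ->; congr (f _); exact: (eqz_valE a).
Qed.

(* The contravariant action of the functor SplExt(-, X) on morphisms. *)
Definition SplExt_map (X B B' : nil2AComType F) (f : {ahom B' -> B})
  (c : SplExt B X) : SplExt B' X := se_class (se_pullback f (se_repr c)).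

Lemma SplExt_map_class (X B B' : nil2AComType F) (f : {ahom B' -> B}) E :
  SplExt_map f (se_class E) = se_class (se_pullback f E : splitExt B' X).
Proof. by apply/se_classP/se_pullback_iso/se_classP; rewrite se_reprK. Qed.

Lemma SplExt_map_id (B X : nil2AComType F) (c : SplExt B X) :
  SplExt_map idfun c = c.
Proof.
rewrite -{2}(se_reprK c); apply/se_classP/se_iso_sym; exact: se_pullback_id.
Qed.

Lemma SplExt_map_comp (B B' B'' X : nil2AComType F) (f : {ahom B' -> B})
  (g : {ahom B'' -> B'}) (c : SplExt B X) :
  SplExt_map (f \o g) c = SplExt_map g (SplExt_map f c).
Proof.
rewrite [SplExt_map f c]/SplExt_map SplExt_map_class; apply/esym/se_classP.
exact: se_pullback_comp.
Qed.

Section DerivedAction.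
Variables (B X : nil2AComType F) (E : splitExt B X).

Lemma dact_subproof b x : exists y, se_i E y = se_s E b ** se_i E x.
Proof.
by apply: (kernel_surj (se_ker E)); rewrite ahomM (se_ker E).1 amul0r.
Qed.

(* [dact b x] is b * x; by anticommutativity x * b is its opposite. *)
Definition dact (b : B) (x : X) : X := projT1 (cid (dact_subproof b x)).

Lemma dactP b x : se_i E (dact b x) = se_s E b ** se_i E x.
Proof. exact: projT2 (cid (dact_subproof b x)). Qed.

Lemma dact_bracket2 b : dact b \in bracket2_pred (X := X).
Proof.
apply/asboolP; have iI := kernel_inj (se_ker E); split=> [a x y|x y].
  by apply: iI; rewrite linearP /= !dactP linearP /= amulDr amulZr.
split; apply: iI; rewrite linear0; first by rewrite dactP ahomM amul_nil2r.
by rewrite ahomM dactP amul_nil2l.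
Qed.

Definition dact_hom_fun (b : B) : bracket2 X := Bracket2 (dact_bracket2 b).

Lemma dact_hom_linear : linear dact_hom_fun.
Proof.
move=> a b b'; apply: bracket2_ext => x; apply: (kernel_inj (se_ker E)).
rewrite -[RHS]/(se_i E (a *: dact b x + dact b' x)) /= dactP.
by rewrite !linearP /= !dactP amulDl amulZl.
Qed.

Lemma dact_homM : {morph dact_hom_fun : b b' / b ** b' >-> b ** b'}.
Proof.
move=> b b'; apply: bracket2_ext => x; apply: (kernel_inj (se_ker E)).
by rewrite -[RHS]/(se_i E 0) /= dactP ahomM amul_nil2l linear0.
Qed.

HB.instance Definition _ := GRing.isLinear.Build F B (bracket2 X) *:%R
  dact_hom_fun dact_hom_linear.
HB.instance Definition _ := isMultiplicative.Build F B (bracket2 X)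
  dact_hom_fun dact_homM.

Definition dact_hom : {ahom B -> bracket2 X} := dact_hom_fun.
End DerivedAction.

Lemma dact_hom_iso (B X : nil2AComType F) (E E' : splitExt B X) :
  se_iso E E' -> dact_hom E = dact_hom E'.
Proof.
move=> [u [v [uK vK ui pu us]]]; apply: ahom_ext => b; apply: bracket2_ext => x.
by apply: (kernel_inj (se_ker E')); rewrite /= -ui !dactP ahomM us ui.
Qed.

(* [tau2_class] below: the value does not depend on the representative. *)
Definition tau2 (X B : nil2AComType F) (c : SplExt B X) :
  {ahom B -> bracket2 X} := dact_hom (se_repr c).

Lemma tau2_class (X B : nil2AComType F) (E : splitExt B X) :
  tau2 (se_class E) = dact_hom E.
Proof. by apply/dact_hom_iso/se_classP; rewrite se_reprK. Qed.

Definition dagger (B X : nil2AComType F) (phi : {ahom B -> bracket2 X}) : Prop :=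
  forall (b b' : B) (x : X), phi b (phi b' x) = 0.

Definition weak_representation (X T : nil2AComType F)
    (tau : forall B : nil2AComType F, SplExt B X -> {ahom B -> T}) : Prop :=
  (forall B : nil2AComType F, injective (tau B)) /\
  (forall (B B' : nil2AComType F) (f : {ahom B' -> B}) (c : SplExt B X),
     tau B' (SplExt_map f c) = tau B c \o f :> {ahom B' -> T}).

Definition acting_morphism (X T : nil2AComType F)
    (tau : forall B : nil2AComType F, SplExt B X -> {ahom B -> T})
    (B : nil2AComType F) (phi : {ahom B -> T}) : Prop :=
  exists c : SplExt B X, tau B c = phi.

End SplitExtensions.

Definition weakly_action_representable_Nil2ACom (F : fieldType) : Prop :=
  forall X : nil2AComType F, exists (T : nil2AComType F)
    (tau : forall B : nil2AComType F, SplExt B X -> {ahom B -> T}),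
    weak_representation tau.

(* Main.v *)
From Pilot Require Import Defs.
From HB Require Import structures.
From mathcomp Require Import all_boot all_order all_algebra.
From mathcomp Require Import mathcomp_extra boolp classical_sets functions.

(* A homomorphism phi : B -> [X]_2 satisfying the dagger condition makes the
   space X * B an algebra of the variety under
     (x, b) (x', b') = (x x' + b * x' - b' * x, b b');
   dagger is exactly what kills the summands b'' * (b * x') of a triple product.
   Conversely, in any split extension b * (b' * x) = s(b) (s(b') i(x)) = 0, and
   (x, b) |-> i(x) + s(b) identifies it with the semidirect product of its own
   derived action, so that the action determines the extension. *)

Set Implicit Arguments.
Unset Strict Implicit.
Unset Printing Implicit Defensive.

Import GRing.Theory.
Local Open Scope ring_scope.
Local Open Scope classical_set_scope.

(** * Pointwise rules for elements of $[X]_2$ *)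

Section Bracket2Facts.
Variables (F : fieldType) (X : nil2AComType F) (f : bracket2 X).

Lemma bracket2_linear : linear f.
Proof. exact: (bracket2P f).1. Qed.

Lemma bracket2D x y : f (x + y) = f x + f y.
Proof. by have := bracket2_linear 1 x y; rewrite !scale1r. Qed.

Lemma bracket2_0 : f 0 = 0.
Proof. by apply: (addIr (f 0)); rewrite -bracket2D !add0r. Qed.

Lemma bracket2Z a x : f (a *: x) = a *: f x.
Proof. by have := bracket2_linear a x 0; rewrite bracket2_0 !addr0. Qed.

Lemma bracket2N x : f (- x) = - f x.
Proof. by rewrite -scaleN1r bracket2Z scaleN1r. Qed.

Lemma bracket2M x y : f (x ** y) = 0.
Proof. exact: ((bracket2P f).2 x y).1. Qed.

Lemma amul_bracket2l x y : f x ** y = 0.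
Proof. exact: ((bracket2P f).2 x y).2. Qed.

End Bracket2Facts.

Lemma bracket2_addE (F : fieldType) (X : nil2AComType F) (f g : bracket2 X) x :
  (f + g) x = f x + g x.
Proof. by []. Qed.

Lemma bracket2_scaleE (F : fieldType) (X : nil2AComType F) a (f : bracket2 X) x :
  (a *: f) x = a *: f x.
Proof. by []. Qed.

Lemma bracket2_amulE (F : fieldType) (X : nil2AComType F) (f g : bracket2 X) x :
  (f ** g) x = 0.
Proof. by []. Qed.

(** * The semidirect product with action [phi], as a split extension *)

Section SemidirectProduct.
Variables (F : fieldType) (B X : nil2AComType F).
Variables (phi : {ahom B -> bracket2 X}) (dphi : dagger phi).

(** A copy of the module [X * B], whose own multiplication is componentwise. The proof of dagger is
    a parameter of the type because the nilpotency instance depends on it. *)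
Definition sdprod of dagger phi : Type := (X * B)%type.
Local Notation S := (sdprod dphi).
HB.instance Definition _ := GRing.Lmodule.copy S (X * B)%type.

Definition sd_amul (p q : S) : S :=
  (p.1 ** q.1 + phi p.2 q.1 - phi q.2 p.1, p.2 ** q.2).

Lemma sd_amulC_subproof p q : sd_amul p q = - sd_amul q p.
Proof.
apply: injective_projections; rewrite /=; last exact: amulC.
by rewrite [p.1 ** _]amulC !opprD opprK addrAC.
Qed.

Lemma sd_amul_linearr p : linear (sd_amul p).
Proof.
move=> a q q'; apply: injective_projections => /=; last by rewrite amulDr amulZr.
rewrite amulDr amulZr bracket2D bracket2Z (linearP phi).
rewrite bracket2_addE bracket2_scaleE !scalerDr scalerN opprD.
by rewrite [RHS]addrACA [X in _ = X + _]addrACA.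
Qed.

(** Anticommutativity reduces this to linearity on the right. *)
Lemma sd_amul_linearl q : linear (sd_amul^~ q).
Proof.
move=> a p p'; rewrite /= sd_amulC_subproof sd_amul_linearr.
by rewrite opprD -scalerN -!sd_amulC_subproof.
Qed.

HB.instance Definition _ := isNAlgebra.Build F S sd_amul_linearl sd_amul_linearr.

Lemma sd_amulE (p q : S) :
  p ** q = (p.1 ** q.1 + phi p.2 q.1 - phi q.2 p.1, p.2 ** q.2).
Proof. by []. Qed.

Lemma sd_amulC (p q : S) : p ** q = - (q ** p).
Proof. exact: sd_amulC_subproof. Qed.

Lemma sd_amul_nil2l (p q r : S) : (p ** q) ** r = 0.
Proof.
rewrite !sd_amulE /=; apply: injective_projections; rewrite /= ?amul_nil2l //.
rewrite ahomM !bracket2D !bracket2N bracket2M !dphi !amulDl amul_nil2l.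
(* The action of [p.2 ** q.2] vanishes since $[X]_2$ is abelian. Moving the sign inside [phi] gives
   the last product the form [f x ** y], which is zero. *)
rewrite bracket2_amulE -bracket2N !amul_bracket2l oppr0 !addr0 oppr0; exact: addr0.
Qed.

Lemma sd_amul_nil2r (p q r : S) : p ** (q ** r) = 0.
Proof. by rewrite sd_amulC sd_amul_nil2l oppr0. Qed.

HB.instance Definition _ := isNil2ACom.Build F S
  sd_amulC sd_amul_nil2r sd_amul_nil2l.

Definition sd_i (x : X) : S := (x, 0).
Definition sd_p (p : S) : B := p.2.
Definition sd_s (b : B) : S := (0, b).

Lemma sd_i_linear : linear sd_i.
Proof.
by move=> a x y; apply: injective_projections; rewrite //= scaler0 addr0.
Qed.
Lemma sd_iM : {morph sd_i : x y / x ** y >-> x ** y}.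
Proof.
move=> x y; rewrite sd_amulE; apply: injective_projections; rewrite /= ?amul0l //.
by rewrite linear0 subr0 addr0.
Qed.
HB.instance Definition _ := GRing.isLinear.Build F X S *:%R sd_i sd_i_linear.
HB.instance Definition _ := Defs.isMultiplicative.Build F X S sd_i sd_iM.

Lemma sd_p_linear : linear sd_p.
Proof. by []. Qed.
Lemma sd_pM : {morph sd_p : p q / p ** q >-> p ** q}.
Proof. by []. Qed.
HB.instance Definition _ := GRing.isLinear.Build F S B *:%R sd_p sd_p_linear.
HB.instance Definition _ := Defs.isMultiplicative.Build F S B sd_p sd_pM.

Lemma sd_s_linear : linear sd_s.
Proof.
by move=> a x y; apply: injective_projections; rewrite //= scaler0 addr0.
Qed.
Lemma sd_sM : {morph sd_s : b b' / b ** b' >-> b ** b'}.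
Proof.
move=> b b'; rewrite sd_amulE; apply: injective_projections => //=.
by rewrite amul0l !bracket2_0 subr0 addr0.
Qed.
HB.instance Definition _ := GRing.isLinear.Build F B S *:%R sd_s sd_s_linear.
HB.instance Definition _ := Defs.isMultiplicative.Build F B S sd_s sd_sM.

Section KernelLift.
Variables (Z : nAlgebraType F) (h : {ahom Z -> S}).
Hypothesis ph0 : forall z, sd_p (h z) = 0.

(** The first projection of the semidirect product is not multiplicative in general; it becomes so
    along [h] because the action terms vanish with the [B]-components. Hence the hypothesis is an
    argument, on which the instances can depend. *)
Definition sd_lift of (forall z, sd_p (h z) = 0) := fun z : Z => (h z).1.

Lemma sd_lift_linear : linear (sd_lift ph0).
Proof. by move=> a x y; rewrite /sd_lift linearP. Qed.
Lemma sd_liftM : {morph sd_lift ph0 : x y / x ** y >-> x ** y}.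
Proof.
move=> x y; rewrite /sd_lift ahomM sd_amulE /=.
by have := ph0 x; have := ph0 y; rewrite /sd_p => -> ->; rewrite linear0 subr0 addr0.
Qed.
HB.instance Definition _ := GRing.isLinear.Build F Z X *:%R (sd_lift ph0)
  sd_lift_linear.
HB.instance Definition _ := Defs.isMultiplicative.Build F Z X (sd_lift ph0) sd_liftM.
End KernelLift.

Lemma sd_ker : is_kernel sd_i sd_p.
Proof.
split=> [//|Z h ph0]; exists (sd_lift ph0 : {ahom Z -> X}); split=> [z|k kP].
  by apply: injective_projections => //=; exact: esym (ph0 z).
by apply: ahom_ext => z; rewrite /= /sd_lift -kP.
Qed.

Lemma sd_sK b : sd_p (sd_s b) = b.
Proof. by []. Qed.

Definition sd_ext : splitExt B X := SplitExt sd_sK sd_ker.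

(** In the semidirect product, $(0, b)(x, 0) = (b * x, 0)$. *)
Lemma dact_hom_sd_ext : dact_hom sd_ext = phi.
Proof.
apply: ahom_ext => b; apply: bracket2_ext => x; apply: (kernel_inj (se_ker sd_ext)).
rewrite [LHS]dactP; apply: injective_projections => /=; last by rewrite amul0r.
by rewrite amul0l add0r bracket2_0 subr0.
Qed.

End SemidirectProduct.

(** * Recovering a split extension from its derived action *)

Section Reconstruction.
Variables (F : fieldType) (B X : nil2AComType F).
Variables (phi : {ahom B -> bracket2 X}) (dphi : dagger phi).
Variables (E : splitExt B X) (phiE : dact_hom E = phi).

Definition sd_to_ext of dact_hom E = phi := fun p : sdprod dphi =>
  se_i E p.1 + se_s E p.2.
Local Notation w := (sd_to_ext phiE).

Lemma sd_to_ext_linear : linear w.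
Proof.
by move=> a p q; rewrite /sd_to_ext !linearP /= scalerDr addrACA.
Qed.

(** Of the four products in $(i(x) + s(b))(i(x') + s(b'))$, the mixed ones are $s(b) i(x') = i(b *
    x')$ and, by anticommutativity, $i(x) s(b') = - i(b' * x)$. *)
Lemma sd_to_extM : {morph w : p q / p ** q >-> p ** q}.
Proof.
have phiP b x : se_i E (phi b x) = se_s E b ** se_i E x.
  by rewrite -phiE -dactP.
move=> p q; rewrite /sd_to_ext sd_amulE /= linearB linearD /= !ahomM !phiP.
rewrite amulDl !amulDr [se_i E p.1 ** se_s E _]amulC.
by rewrite -!addrA; congr (_ + _); rewrite addrCA.
Qed.
HB.instance Definition _ := GRing.isLinear.Build F (sdprod dphi) (se_obj E)
  *:%R w sd_to_ext_linear.
HB.instance Definition _ := Defs.isMultiplicative.Build F (sdprod dphi) (se_obj E)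
  w sd_to_extM.

(** By the split short five lemma, compatibility with the three structure maps suffices; no inverse
    has to be built. *)
Lemma sd_ext_iso : se_iso (sd_ext dphi) E.
Proof.
apply: (se_iso_morphism (E := sd_ext dphi) (u := w)) => [x|p|b].
- by rewrite /= /sd_to_ext /= linear0 addr0.
- by rewrite /= /sd_to_ext linearD /= (se_ker E).1 se_sK add0r.
- by rewrite /= /sd_to_ext /= linear0 add0r.
Qed.

End Reconstruction.

(** * Classification by actions, and naturality *)

Section Classification.
Variables (F : fieldType).
Implicit Types B X : nil2AComType F.

Lemma dact_hom_dagger B X (E : splitExt B X) : dagger (dact_hom E).
Proof.
move=> b b' x; apply: (kernel_inj (se_ker E)).
by rewrite [LHS]dactP [X in _ ** X]dactP amul_nil2r linear0.
Qed.

(** Both extensions are isomorphic to the semidirect product of their common action. *)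
Lemma dact_hom_inj B X (E E' : splitExt B X) :
  dact_hom E = dact_hom E' -> se_iso E E'.
Proof.
move=> EE'; have dE' := dact_hom_dagger E'.
exact: se_iso_trans (se_iso_sym (sd_ext_iso dE' EE')) (sd_ext_iso dE' erefl).
Qed.

Lemma tau2_inj B X : injective (@tau2 F X B).
Proof.
move=> c c' /dact_hom_inj cc'.
by rewrite -(se_reprK c) -(se_reprK c'); apply/se_classP.
Qed.

Lemma tau2_sd_ext B X (phi : {ahom B -> bracket2 X}) (dphi : dagger phi) :
  tau2 (se_class (sd_ext dphi)) = phi.
Proof. by rewrite tau2_class dact_hom_sd_ext. Qed.

Lemma dact_hom_pullback B B' X (f : {ahom B' -> B}) (E : splitExt B X) :
  dact_hom (se_pullback f E) = dact_hom E \o f :> {ahom B' -> bracket2 X}.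
Proof.
apply: ahom_ext => b; apply: bracket2_ext => x; apply: (kernel_inj (se_ker E)).
rewrite [RHS]dactP.
(* The pullback multiplies componentwise in [se_obj E * B'], so the first component of its action
   equation is the one for [f b] in [E]. *)
exact: (congr1 (fun a => (val a).1) (dactP (se_pullback f E) b x)).
Qed.

Lemma tau2_weak_representation X : weak_representation (@tau2 F X).
Proof.
split=> [B|B B' f c]; first exact: tau2_inj.
by rewrite tau2_class dact_hom_pullback.
Qed.

End Classification.

Theorem theorem2p21 (F : fieldType) :
  [/\ forall B X : nil2AComType F,
        set_bij [set: SplExt B X]
                [set phi : {ahom B -> bracket2 X} | dagger phi]
                (@tau2 F X B),
      weakly_action_representable_Nil2ACom F /\
        (forall X : nil2AComType F, weak_representation (@tau2 F X))
    & forall (B X : nil2AComType F) (phi : {ahom B -> bracket2 X}),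
        acting_morphism (@tau2 F X) phi <-> dagger phi].
Proof.
split=> [B X||B X phi].
(* [tau2 c] is by definition the action of a chosen representative of [c]. *)
- split=> [c _|c c' _ _|phi dphi]; first exact: dact_hom_dagger.
    exact: tau2_inj.
  by exists (se_class (sd_ext dphi)); last exact: tau2_sd_ext.
- split=> X; last exact: tau2_weak_representation.
  by exists (bracket2 X), (@tau2 F X); exact: tau2_weak_representation.
- split=> [[c <-]|dphi]; first exact: dact_hom_dagger.
  by exists (se_class (sd_ext dphi)); exact: tau2_sd_ext.
Qed.
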